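(* Let $f:\mathbb{R}^d\to[0,\infty)$ be a probability density (with respect to Lebesgue measure) that is twice continuously differentiable and of Morse type inside its support. For $x\in\mathbb{R}^d$ let $\zeta_x$ be the gradient flow line $$\zeta_x(0)=x;\qquad \dot\zeta_x(\tau)=\begin{cases}\dfrac{\nabla f(\zeta_x(\tau))}{\|\nabla f(\zeta_x(\tau))\|^2}, & \text{if }\nabla f(\zeta_x(\tau))\neq 0;\\[2mm] 0,&\text{otherwise.}\end{cases}$$ Then: (1) Starting from a point $x$ at level $t>0$, meaning that $f(x)=t$, it holds that $f(\zeta_x(s-t))=s$ for all $t<s<\max f$ as long as $\nabla f(y)\neq 0$ for all $y\in\{\zeta_x(\tau):\tau\in[0,s-t]\}$. (2) In fact, the transformation $x\mapsto\zeta_x(s-t)$ provides a homeomorphism from $\mathcal{L}_t$ to $\mathcal{L}_s$ (where $0<t<s<\max f$) whenever there are no critical points of $f$ at any level anywhere between $t$ and $s$, inclusive (i.e., no $x$ with $t\le f(x)\le s$ and $\nabla f(x)=0$).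
   Context: For $u>0$, $\mathcal{L}_u:=\{x\in\mathbb{R}^d: f(x)=u\}$ is the level set of $f$ at level $u$, with the subspace topology from $\mathbb{R}^d$. The density $f$ is of Morse type inside its support if the Hessian $\nabla^2 f(x)$ is non-degenerate at every critical point $x$ (i.e., $\nabla f(x)=0$) of $f$ inside its support. $\|\cdot\|$ is the Euclidean norm.
   Formalization: The flow line is assumed to exist in both time directions for all τ > −f(x), so it never escapes to infinity at a positive level (otherwise (2) can fail); at a critical point, ''0 otherwise'' is read as the curve staying there, with no two-sided derivative required on arrival. *)

(* Defs.v *)
From HB Require Import structures.
From mathcomp Require Import all_boot all_order all_algebra.
From mathcomp Require Import all_classical all_reals all_analysis.

Set Implicit Arguments.
Unset Strict Implicit.
Unset Printing Implicit Defensive.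
Import Order.TTheory GRing.Theory Num.Theory.
Import numFieldNormedType.Exports.
Local Open Scope classical_set_scope.
Local Open Scope ring_scope.

Definition cons_pair (R : realType) (n : nat) (p : R * n.-tuple R) :
  n.+1.-tuple R := [tuple of p.1 :: p.2].

Lemma measurable_cons_pair (R : realType) (n : nat) :
  measurable_fun [set: R * n.-tuple R] (@cons_pair R n).
Proof. exact: measurable_cons. Qed.

Section lebesgue_step.
Context (R : realType) (n : nat).
Variable mu : {sigma_finite_measure set (n.-tuple R) -> \bar R}.
Let leb : {sigma_finite_measure set (measurableTypeR R) -> \bar R} :=
  @lebesgue_measure R.

Definition lebesgue_cons : set (n.+1.-tuple R) -> \bar R :=
  pushforward (leb \x mu)%E (@cons_pair R n).

Let lebesgue_cons0 : lebesgue_cons set0 = 0%E.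
Proof. by rewrite /lebesgue_cons /pushforward preimage_set0 measure0. Qed.

Let lebesgue_cons_ge0 A : (0 <= lebesgue_cons A)%E.
Proof. by rewrite /lebesgue_cons /pushforward; exact: measure_ge0. Qed.

Let lebesgue_cons_sigma_additive : semi_sigma_additive lebesgue_cons.
Proof.
move=> F mF tF mUF; rewrite /lebesgue_cons /pushforward preimage_bigcup.
have mF' i : measurable (@cons_pair R n @^-1` F i).
  by rewrite -[X in measurable X]setTI; exact: measurable_cons_pair.
apply: measure_semi_sigma_additive => //.
- apply/trivIsetP => /= i j _ _ ij; rewrite -preimage_setI.
  by move/trivIsetP : tF => /(_ i j Logic.I Logic.I ij) ->; rewrite preimage_set0.
- exact: bigcupT_measurable.
Qed.

HB.instance Definition _ := isMeasure.Build _ _ _ lebesgue_cons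
  lebesgue_cons0 lebesgue_cons_ge0 lebesgue_cons_sigma_additive.

Let lebesgue_cons_sigma_finite : sigma_finite setT lebesgue_cons.
Proof.
have /sigma_finiteP[F [TF ndF Foo]] := sigma_finiteT leb.
have /sigma_finiteP[G [TG ndG Goo]] := sigma_finiteT mu.
pose g (v : n.+1.-tuple R) : measurableTypeR R * n.-tuple R :=
  (thead v, [tuple of behead v]).
have mg : measurable_fun setT g.
  apply: measurable_fun_pair; first exact: measurable_tnth.
  exact: measurable_behead.
exists (fun k => g @^-1` (F k `*` G k)).
  apply/esym/seteqP; split=> // v _.
  have [k _ Fk] : (\bigcup_k F k) (g v).1 by rewrite -TF.
  have [l _ Gl] : (\bigcup_k G k) (g v).2 by rewrite -TG.
  exists (maxn k l) => //; split.
  - by move: Fk; exact/subsetPset/ndF/leq_maxl.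
  - by move: Gl; exact/subsetPset/ndG/leq_maxr.
move=> k; have [mFk Fkoo] := Foo k; have [mGk Gkoo] := Goo k; split.
  by rewrite -[X in measurable X]setTI; apply: mg => //; exact: measurableX.
rewrite /lebesgue_cons /pushforward -comp_preimage.
rewrite (_ : g \o @cons_pair R n = id); last first.
  by apply/funext => -[x v]; rewrite /g /cons_pair /= theadE; congr pair;
    exact: val_inj.
rewrite preimage_id product_measure1E//.
by rewrite lte_mul_pinfty// ge0_fin_numE.
Qed.

HB.instance Definition _ := Measure_isSigmaFinite.Build _ _ _ lebesgue_cons
  lebesgue_cons_sigma_finite.

End lebesgue_step.

(* Lebesgue measure on R^d, carried by d-tuples because the library puts the
   product sigma-algebra on tuples and not on row vectors. *)
Fixpoint lebesgue_tuple (R : realType) (d : nat) :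
    {sigma_finite_measure set (d.-tuple R) -> \bar R} :=
  match d with
  | 0 => \d_ ([tuple] : 0.-tuple R)
  | d'.+1 => lebesgue_cons (lebesgue_tuple R d')
  end.

(* Measurability of f is not required here: it is only used for continuous f. *)
Definition probability_density (R : realType) (d : nat) (f : 'rV[R]_d -> R) :=
  (forall x, 0 <= f x) /\
  (\int[lebesgue_tuple R d]_v (f (\row_i tnth v i))%:E = 1)%E.

Definition enorm (R : realType) (d : nat) (v : 'rV[R]_d) : R :=
  Num.sqrt (\sum_i v 0 i ^+ 2).

Definition gradient (R : realType) (d : nat) (f : 'rV[R]_d -> R)
  (x : 'rV[R]_d) : 'rV[R]_d := \row_i 'D_(delta_mx 0 i) f x.

Definition hessian (R : realType) (d : nat) (f : 'rV[R]_d -> R)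
  (x : 'rV[R]_d) : 'M[R]_d := 'J (gradient f) x.

Definition twice_continuously_differentiable (R : realType) (d : nat)
    (f : 'rV[R]_d -> R) :=
  [/\ forall x, differentiable f x,
      forall x, differentiable (gradient f) x &
      continuous (hessian f)].

Definition critical (R : realType) (d : nat) (f : 'rV[R]_d -> R)
  (x : 'rV[R]_d) := gradient f x = 0.

Definition morse_inside_support (R : realType) (d : nat) (f : 'rV[R]_d -> R) :=
  forall x, 0 < f x -> critical f x -> hessian f x \in unitmx.

Definition level_set (R : realType) (d : nat) (f : 'rV[R]_d -> R) (u : R) :
  set 'rV[R]_d := [set x | f x = u].

(* This is max f whenever the maximum is attained; attainment is not assumed. *)
Definition max_value (R : realType) (d : nat) (f : 'rV[R]_d -> R) : \bar R :=
  ereal_sup (range (fun x => (f x)%:E)).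

Definition flow_field (R : realType) (d : nat) (f : 'rV[R]_d -> R)
    (y : 'rV[R]_d) : 'rV[R]_d :=
  if gradient f y == 0 then 0
  else (enorm (gradient f y) ^+ 2)^-1 *: gradient f y.

(* z is the integral curve of [flow_field f] through x.
   - Off critical points f (z tau) = f x + tau, so the levels f (z tau) > 0 are
     those of the times tau > - f x; nothing is asked at earlier times, where
     the curve may not extend (it escapes to infinity for a Gaussian f).
   - z lives at all times tau > - f x: it does not run off to infinity at a
     positive level. Such a z exists for every x when f vanishes at infinity
     and is of Morse type.
   - The speed 1 / ||gradient|| is unbounded near a nondegenerate critical
     point, so a curve reaching one has no two-sided derivative at that instant,
     and the zero branch of the field is expressed by the curve staying there,
     in the direction of travel away from time 0. Asking for a two-sided
     derivative equal to [flow_field f (z tau)] at every tau >= 0 would be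
     unsatisfiable at any noncritical x as soon as f is bounded. *)
Definition gradient_flow_line (R : realType) (d : nat) (f : 'rV[R]_d -> R)
    (x : 'rV[R]_d) (z : R -> 'rV[R]_d) :=
  [/\ z 0 = x,
      forall tau, - f x < tau -> {for tau, continuous z},
      forall tau, - f x < tau -> ~ critical f (z tau) ->
        is_derive tau 1 z (flow_field f (z tau)) &
      forall tau tau', - f x < tau' ->
        (0 <= tau <= tau') || (tau' <= tau <= 0) ->
        critical f (z tau) -> z tau' = z tau].

Definition homeomorphism_between (T U : topologicalType) (A : set T)
    (B : set U) (phi : T -> U) :=
  [/\ set_bij A B phi, {within A, continuous phi} &
      exists psi : U -> T,
        (forall x, A x -> psi (phi x) = x) /\ {within B, continuous psi}].

(* Main.v *)
(* Along a curve of the flow the chain rule gives (f o zeta)' = 1 off critical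
   points, hence f (zeta tau) = f x + tau by the mean value theorem. If the
   levels between t and s carry no critical point, a first critical time would,
   by continuity, be reached at such a level, so there is none.
   The field is the inversion of a C^1 gradient, so it is Lipschitz in a tube
   around a compact noncritical piece of flow line. Gronwall's inequality for the
   squared Euclidean distance then shows that curves starting close to it
   stay in the tube, which yields both continuous dependence on the initial point
   and uniqueness. By uniqueness, flowing down from level s is inverse to flowing
   up from level t. *)
Require Import Defs.
From HB Require Import structures.
From mathcomp Require Import all_boot all_order all_algebra.
From mathcomp Require Import all_classical all_reals all_analysis.
From mathcomp Require Import ring lra.

Set Implicit Arguments.
Unset Strict Implicit.
Unset Printing Implicit Defensive.
Import Order.TTheory GRing.Theory Num.Theory.
Import numFieldNormedType.Exports.
Local Open Scope classical_set_scope.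
Local Open Scope ring_scope.

(** * Sup norm, squared Euclidean norm and inversion *)

Lemma coord_le_norm (R : realType) (m n : nat) (A : 'M[R]_(m, n)) i j :
  `|A i j| <= `|A|.
Proof.
rewrite [leRHS]/Num.Def.normr/= mx_normrE.
exact: (le_bigmax _ (fun ij : 'I_m * 'I_n => `|A ij.1 ij.2|) (i, j)).
Qed.

(** The norm carried by matrices is the sup norm. The squared Euclidean norm is polynomial in the
    coordinates, hence differentiable along every differentiable curve. *)
Definition sqnorm (R : realType) (d : nat) (v : 'rV[R]_d) : R :=
  \sum_i v 0 i ^+ 2.

Section sqnorm.
Context {R : realType} {d : nat}.
Implicit Types v w : 'rV[R]_d.

Lemma sqnorm_ge0 v : 0 <= sqnorm v.
Proof. by apply: sumr_ge0 => i _; exact: sqr_ge0. Qed.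

Lemma sqnorm0 : sqnorm (0 : 'rV[R]_d) = 0.
Proof. by rewrite /sqnorm big1// => i _; rewrite mxE expr0n. Qed.

Lemma enorm_sqr v : enorm v ^+ 2 = sqnorm v.
Proof. by rewrite /enorm sqr_sqrtr// sqnorm_ge0. Qed.

Lemma sqnormZ (c : R) v : sqnorm (c *: v) = c ^+ 2 * sqnorm v.
Proof. by rewrite mulr_sumr; apply: eq_bigr => i _; rewrite mxE exprMn. Qed.

Lemma coord_sqr_le_sqnorm v i : v 0 i ^+ 2 <= sqnorm v.
Proof. by rewrite /sqnorm (bigD1 i)//= lerDl; apply: sumr_ge0 => j _; exact: sqr_ge0. Qed.

Lemma sqnorm_eq0 v : (sqnorm v == 0) = (v == 0).
Proof.
apply/idP/eqP => [/eqP v0|->]; last by rewrite sqnorm0.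
apply/rowP => i; rewrite mxE; apply/eqP; rewrite -sqrf_eq0 eq_le sqr_ge0 andbT.
by rewrite -v0 coord_sqr_le_sqnorm.
Qed.

(** Some coordinate realises the sup norm. The bound turns Euclidean estimates into statements about
    the topology, whose balls are sup-norm balls. *)
Lemma norm_sqr_le_sqnorm v : `|v| ^+ 2 <= sqnorm v.
Proof.
have [->|v0] := eqVneq v 0; first by rewrite normr0 expr0n sqnorm_ge0.
have [ij ->] : exists ij, `|v| = `|v ij.1 ij.2|.
  by apply: mx_norm_neq0; apply: contra_neq v0 => /mx_norm_eq0.
by rewrite real_normK ?num_real// ord1 coord_sqr_le_sqnorm.
Qed.

Lemma sqnorm_continuous : continuous (@sqnorm R d).
Proof.
move=> v; rewrite /sqnorm; apply: cvg_big => [|| i _].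
- exact: add_continuous.
- exact: nbhs_filter.
have c : (fun x : 'rV[R]_d => x 0 i) @ v --> v 0 i by exact: coord_continuous.
by rewrite expr2; under eq_fun do rewrite expr2; exact: (cvgM c c).
Qed.

(* [v / ||v||^2] is inversion in the unit sphere, and [flow_field f] is the
   inversion of [gradient f]; this identity makes it locally Lipschitz. *)
Lemma sqnorm_inversion v w : sqnorm v != 0 -> sqnorm w != 0 ->
  sqnorm ((sqnorm v)^-1 *: v - (sqnorm w)^-1 *: w) =
  sqnorm (v - w) / (sqnorm v * sqnorm w).
Proof.
move=> v0 w0.
have expand (a b : R) (x y : 'rV[R]_d) : sqnorm (a *: x - b *: y) =
    a ^+ 2 * sqnorm x - a * b * (\sum_i x 0 i * y 0 i) *+ 2 + b ^+ 2 * sqnorm y.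
  rewrite /sqnorm -mulrnAr -sumrMnl !mulr_sumr -sumrB -big_split/=.
  by apply: eq_bigr => i _; rewrite !mxE; ring.
rewrite expand -[in RHS](scale1r v) -[X in _ = sqnorm (_ - X) / _](scale1r w).
rewrite expand !scale1r; field.
by rewrite v0 w0.
Qed.

End sqnorm.

(** * Calculus along curves, real induction and Gronwall's inequality *)

Section curves.
Context {R : realType}.

Lemma is_derive_coord (d : nat) (z : R -> 'rV[R]_d) (t : R) (dz : 'rV[R]_d) i :
  is_derive t 1 z dz -> is_derive t 1 (fun x => z x 0 i) (dz 0 i).
Proof.
move=> [zt <-]; apply: DeriveDef; first exact: (derivable_mxP _ _ _).1.
by rewrite derive_mx// mxE.
Qed.

Lemma is_derive_sqnorm (d : nat) (z : R -> 'rV[R]_d) (t : R) (dz : 'rV[R]_d) :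
  is_derive t 1 z dz ->
  is_derive t 1 (fun x => sqnorm (z x)) (\sum_i 2 * z t 0 i * dz 0 i).
Proof.
move=> zt.
have -> : (fun x => sqnorm (z x)) = \sum_i (fun x => z x 0 i) ^+ 2.
  by apply/funext => x; rewrite fct_sumE.
apply: is_derive_sum => i.
have := is_deriveX 2 (is_derive_coord i zt).
by rewrite expr1 /GRing.scale/=.
Qed.

Lemma is_derive_comp_curve (V W : normedModType R) (g : V -> W) (z : R -> V)
    (t : R) (dz : V) : differentiable g (z t) -> is_derive t 1 z dz ->
  is_derive t 1 (g \o z) ('d g (z t) dz).
Proof.
move=> gz [zt <-]; have zt' : differentiable z t by exact/derivable1_diffP.
have gzt : differentiable (g \o z) t by exact: differentiable_comp.
apply: DeriveDef; first exact: diff_derivable.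
by rewrite [LHS]deriveE// diff_comp//= [in RHS](deriveE _ zt').
Qed.

(** The infimum of the failures in [[0, T]] satisfies [P] by the first hypothesis, hence so does a
    neighbourhood of it by the second, which excludes failures arbitrarily close to it. *)
Lemma interval_induction (P : R -> Prop) (T : R) :
  (forall c, 0 <= c <= T -> (forall t, 0 <= t < c -> P t) -> P c) ->
  (forall c, 0 <= c <= T -> P c -> \forall t \near c, P t) ->
  forall t, 0 <= t <= T -> P t.
Proof.
move=> Plim Popen t tT; apply: contrapT => nPt.
pose B := [set x | 0 <= x <= T /\ ~ P x].
have B0 : lbound B 0 by move=> x [/andP[]].
have Bt : B t by split.
have hB : has_inf B by split; [exists t|exists 0].
have infB : 0 <= inf B <= T.
  apply/andP; split; first by apply: lb_le_inf => //; exists t.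
  by apply: le_trans (ge_inf _ Bt) _; [exists 0|case/andP: tT].
have Pinf : P (inf B).
  apply: Plim => // x /andP[x0 xB]; apply: contrapT => nPx.
  have : inf B <= x.
    apply: ge_inf; first by exists 0.
    split=> //; rewrite x0 ltW// (lt_le_trans xB)//.
    by case/andP : infB.
  by rewrite leNgt xB.
have /nbhs_ballP[e /= e0 eP] := Popen _ infB Pinf.
have [x Bx xe] := inf_adherent e0 hB.
case: (Bx) => _; apply; apply: eP.
rewrite /ball/= distrC ger0_norm ?subr_ge0; last by apply: ge_inf => //; exists 0.
by rewrite ltrBlDl.
Qed.

(** The product [g t * expR (- K * t)] has nonpositive derivative. The inequality is required only
    before [T], which suits continuation arguments where nothing is known yet at the endpoint. *)
Lemma gronwall_diff (g dg : R -> R) (K T : R) : 0 <= T ->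
  (forall t : R, 0 <= t <= T -> is_derive t 1 g (dg t)) ->
  (forall t : R, 0 <= t < T -> dg t <= K * g t) ->
  g T <= g 0 * expR (K * T).
Proof.
move=> T0 gdg dgK.
pose e (t : R) := expR (- K * t).
have de (t : R) : is_derive t 1 e (expR (- K * t) * (- K)).
  have H : is_derive t 1 (fun x : R => - K * x) (- K).
    have := is_deriveZ (- K) (is_derive_id t (1 : R)).
    by rewrite /GRing.scale/= mulr1.
  exact: is_derive1_comp.
pose dh (t : R) := g t *: (expR (- K * t) * - K) + e t *: dg t.
have hdh (t : R) : 0 <= t <= T -> is_derive t 1 (g * e) (dh t).
  by move=> tT; exact: (is_deriveM (gdg _ tT) (de t)).
have hc : {within `[0, T], continuous (g * e)}.
  apply: derivable_within_continuous => x; rewrite in_itv/= => xT.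
  by case: (hdh _ xT).
have mono : (g * e) T <= (g * e) 0.
  apply: (ler0_derive1_le_cc _ _ hc) => //; rewrite ?in_itv/= ?lexx ?T0//.
    by move=> x; rewrite in_itv/= => /andP[x0 xT]; have [] := hdh x; first by rewrite !ltW.
  move=> x; rewrite in_itv/= => /andP[x0 xT].
  have [] := hdh x; first by rewrite !ltW.
  rewrite derive1E => _ ->.
  rewrite /dh /e /GRing.scale/= mulrCA -mulrDr pmulr_rle0 ?expR_gt0//.
  by rewrite mulrN addrC subr_le0 mulrC dgK// ltW.
move: mono; rewrite /e !fctE mulr0 expR0 mulr1 mulNr expRN.
by rewrite ler_pdivrMr// expR_gt0.
Qed.

End curves.

(** * Local Lipschitz bounds and stability of integral curves *)

Definition locally_lipschitz_at (R : realType) (d n : nat)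
    (v : 'rV[R]_d -> 'rV[R]_n) (p : 'rV[R]_d) :=
  exists M r : R, 0 < r /\ forall y y', ball p r y -> ball p r y' ->
    sqnorm (v y - v y') <= M * sqnorm (y - y').

Section lipschitz.
Context {R : realType}.

Lemma C1_locally_lipschitz (d n : nat) (g : 'rV[R]_d -> 'rV[R]_n) p :
  (forall x, differentiable g x) -> {for p, continuous (jacobian g)} ->
  locally_lipschitz_at g p.
Proof.
move=> dg /cvgrPdist_lt /(_ 1 ltr01) /nbhs_ballP[r /= r0 Jr].
pose B := `|jacobian g p| + 1.
have entryB (X Y : 'M[R]_(d, n)) i j : Y i j = X i j - (X - Y) i j.
  by rewrite !mxE subKr.
have JB q i j : ball p r q -> `|jacobian g q i j| <= B.
  move=> /Jr/= /ltW J1.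
  rewrite (entryB (jacobian g p)).
  apply: le_trans (ler_normB _ _) _; apply: lerD; first exact: coord_le_norm.
  exact: le_trans (coord_le_norm _ _ _) J1.
(* Each of the [n] coordinates of the increment is a sum of [d] terms, each at most [B] times the
   sup norm of [y - y']. *)
exists (n%:R * (d%:R * B) ^+ 2), r; split=> // y y' py py'.
pose q (t : R) := y' + t *: (y - y').
have qball t : 0 <= t <= 1 -> ball p r (q t).
  move=> /andP[t0 t1]; rewrite mx_norm_ball /ball_/=.
  have -> : p - q t = t *: (p - y) + (1 - t) *: (p - y').
    by apply/rowP => i; rewrite /q !mxE; ring.
  move: py py'; rewrite mx_norm_ball /ball_/= => py py'.
  apply: le_lt_trans (ler_normD _ _) _; rewrite !normrZ ger0_norm// ger0_norm ?subr_ge0//.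
  (* Strictness comes from a product with factor [t], so [t = 0] is treated apart. *)
  have [->|tn0] := eqVneq t 0; first by rewrite mul0r add0r subr0 mul1r.
  have : 0 < t * (r - `|p - y|) by rewrite mulr_gt0 ?subr_gt0// lt0r tn0.
  have : 0 <= (1 - t) * (r - `|p - y'|) by rewrite mulr_ge0 ?subr_ge0// ltW.
  rewrite !mulrBr; lra.
have dq (t : R) : is_derive t 1 q (y - y').
  have dscale : is_derive t 1 ( *:%R^~ (y - y')) (y - y').
    apply: DeriveDef; first exact/derivable1_diffP.
    by rewrite deriveE// diff_val scale1r.
  have := is_deriveD (is_derive_cst y' t 1) dscale.
  by rewrite add0r.
have coordB j : (g y 0 j - g y' 0 j) ^+ 2 <= (d%:R * B) ^+ 2 * sqnorm (y - y').
  pose dh (t : R) := ('d g (q t) (y - y')) 0 j.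
  have hdh (t : R) : is_derive t 1 (fun x => g (q x) 0 j) (dh t).
    by apply: is_derive_coord; exact: is_derive_comp_curve.
  have hc : {within `[0, 1], continuous (fun x => g (q x) 0 j)}.
    apply: (@derivable_within_continuous R R (fun x => g (q x) 0 j) `[0, 1]).
    by move=> x _; have [] := hdh x.
  have [] := MVT_segment ler01 (fun x _ => hdh x) hc.
  move=> c; rewrite in_itv/= => c01.
  have -> : q 1 = y by rewrite /q scale1r addrC subrK.
  have -> : q 0 = y' by rewrite /q scale0r addr0.
  rewrite subr0 mulr1 => ->.
  rewrite /dh -deriveE// deriveEjacobian// mxE.
  apply: (@le_trans _ _ ((d%:R * B * `|y - y'|) ^+ 2)); last first.
    by rewrite exprMn ler_wpM2l ?sqr_ge0// norm_sqr_le_sqnorm.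
  rewrite -(real_normK (num_real _)) lerXn2r ?nnegrE//.
    by rewrite !mulr_ge0// addr_ge0.
  apply: le_trans (ler_norm_sum _ _ _) _.
  have -> : d%:R * B * `|y - y'| = \sum_(i < d) (`|y - y'| * B).
    by rewrite sumr_const card_ord -[in RHS]mulr_natl; ring.
  apply: ler_sum => i _; rewrite normrM ler_pM//; first exact: coord_le_norm.
  by apply: JB; exact: qball.
rewrite -mulrA.
have -> : n%:R * ((d%:R * B) ^+ 2 * sqnorm (y - y')) =
    \sum_(i < n) ((d%:R * B) ^+ 2 * sqnorm (y - y')).
  by rewrite sumr_const card_ord mulr_natl.
by apply: ler_sum => j _; rewrite !mxE.
Qed.

(** A single [M] controls both the thinness of the tube and the Lipschitz constant. Near each time
    every large [M] works, so compactness of [[0, T]] yields one for all times. *)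
Lemma lipschitz_tube (d n : nat) (v : 'rV[R]_d -> 'rV[R]_n)
    (z : R -> 'rV[R]_d) (T : R) :
  (forall t, 0 <= t <= T -> {for t, continuous z}) ->
  (forall t, 0 <= t <= T -> locally_lipschitz_at v (z t)) ->
  exists M, 0 < M /\ forall t, 0 <= t <= T -> forall y,
    M * sqnorm (y - z t) < 1 -> sqnorm (v y - v (z t)) <= M * sqnorm (y - z t).
Proof.
move=> cz lz.
pose P (M t : R) := forall y,
  M * sqnorm (y - z t) < 1 -> sqnorm (v y - v (z t)) <= M * sqnorm (y - z t).
have : \forall M \near +oo, `[0, T] `<=` P M.
  have /compact_near_coveringP := @segment_compact R 0 T; apply.
  move=> t; rewrite /= in_itv/= => tT.
  have [M [r [r0 lv]]] := lz t tT.
  have r20 : 0 < r / 2 by rewrite divr_gt0.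
  (* With [N] above [(r / 2) ^- 2] the tube condition puts [y] within [r / 2] of [z t'], itself
     within [r / 2] of [z t], so both lie in the ball where [v] is Lipschitz. *)
  exists ([set t' | `|z t - z t'| < r / 2],
          [set N | [/\ 0 < N, M < N & (r / 2) ^- 2 < N]]) => /=.
    split; first by move/cvgrPdist_lt : (cz t tT) => /(_ _ r20).
    near=> N; split; near: N; apply: nbhs_pinfty_gt; exact: num_real.
  move=> [t' N] /= [zt' [N0 MN rN]] y yz.
  have yz2 : `|y - z t'| < r / 2.
    rewrite -(@ltr_pXn2r _ 2) ?nnegrE// ?(ltW r20)//.
    apply: le_lt_trans (norm_sqr_le_sqnorm _) _.
    rewrite -(ltr_pM2l N0); apply: lt_le_trans yz _.
    by rewrite -ler_pdivrMr ?exprn_gt0// div1r ltW.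
  apply: le_trans (lv _ _ _ _) _; last by rewrite ler_wpM2r ?sqnorm_ge0// ltW.
    rewrite mx_norm_ball /ball_/= (_ : z t - y = (z t - z t') - (y - z t')).
      by apply: le_lt_trans (ler_normB _ _) _; rewrite (splitr r) ltrD.
    by rewrite opprB addrA subrK.
  rewrite mx_norm_ball /ball_/=; apply: lt_trans zt' _.
  by rewrite ltr_pdivrMr// ltr_pMr// ltr1n.
move=> H.
have [M [M0 HM]] : exists M, 0 < M /\ (`[0, T] `<=` P M).
  near (pinfty_nbhs R) => M; exists M; split; first by near: M; apply: nbhs_pinfty_gt; exact: num_real.
  by near: M.
by exists M; split=> // t tT; apply: HM; rewrite /= in_itv.
Unshelve. all: by end_near. Qed.

(** By [2ab <= a^2 + b^2], the squared distance [u] satisfies [u' <= (1 + M) u] inside the tube, and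
    Gronwall applies. The last hypothesis puts the resulting bound below the threshold of the tube,
    so real induction shows that [w] never leaves it. *)
Lemma integral_curves_close (d : nat) (v : 'rV[R]_d -> 'rV[R]_d)
    (z w : R -> 'rV[R]_d) (T M : R) :
  0 <= T ->
  (forall t : R, 0 <= t <= T -> is_derive t 1 z (v (z t))) ->
  (forall t : R, 0 <= t <= T -> is_derive t 1 w (v (w t))) ->
  0 < M ->
  (forall t, 0 <= t <= T -> forall y,
    M * sqnorm (y - z t) < 1 -> sqnorm (v y - v (z t)) <= M * sqnorm (y - z t)) ->
  M * (sqnorm (w 0 - z 0) * expR ((1 + M) * T)) < 1 ->
  sqnorm (w T - z T) <= sqnorm (w 0 - z 0) * expR ((1 + M) * T).
Proof.
move=> T0 dz dw M0 lipv close0.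
pose u (t : R) := sqnorm (w t - z t).
pose du (t : R) := \sum_i 2 * (w t - z t) 0 i * (v (w t) - v (z t)) 0 i.
have udu (t : R) : 0 <= t <= T -> is_derive t 1 u (du t).
  move=> tT; apply: (@is_derive_sqnorm R d (w - z)).
  exact: (is_deriveB (dw _ tT) (dz _ tT)).
have du_le t : 0 <= t <= T -> M * u t < 1 -> du t <= (1 + M) * u t.
  move=> tT ut; rewrite mulrDl mul1r.
  apply: (@le_trans _ _ (u t + sqnorm (v (w t) - v (z t)))); last first.
    by rewrite lerD2l; exact: lipv.
  rewrite /u /sqnorm -big_split/=; apply: ler_sum => i _.
  set a := (w t - z t) 0 i; set b := (v (w t) - v (z t)) 0 i.
  rewrite -subr_ge0 (_ : _ - _ = (a - b) ^+ 2) ?sqr_ge0//; ring.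
have grow c : 0 <= c <= T -> (forall t, 0 <= t < c -> M * u t < 1) ->
    u c <= u 0 * expR ((1 + M) * c).
  move=> /andP[c0 cT] uc; apply: (@gronwall_diff R u du) => // t /andP[t0 tc].
    by apply: udu; rewrite t0 (le_trans tc).
  by apply: du_le; [rewrite t0 ltW// (lt_le_trans tc)|apply: uc; rewrite t0].
have small t : 0 <= t <= T -> M * u t < 1.
  move: t; apply: interval_induction => [c cT uc|c cT uc].
    apply: le_lt_trans close0; rewrite ler_pM2l//.
    apply: le_trans (grow _ cT uc) _; rewrite ler_wpM2l ?sqnorm_ge0//.
    by rewrite ler_expR ler_pM2l ?addr_gt0//; case/andP: cT.
  have cu : {for c, continuous u}.
    by apply/differentiable_continuous/derivable1_diffP; case: (udu c cT).
  have : M * u t @[t --> c] --> M * u c by apply: cvgMr.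
  by move=> /cvgr_lt; apply.
by apply: grow; rewrite ?T0 ?lexx// => t /andP[t0 tT]; apply: small; rewrite t0 ltW.
Qed.

End lipschitz.

(** * Affine changes of time and scaling of the field *)

Lemma ltrN_mul (R : realDomainType) (u s t : R) :
  0 < u -> 0 < u + s -> 0 <= t <= 1 -> - u < s * t.
Proof.
move=> u0 us0 /andP[t0 t1]; have [s0|s0] := leP 0 s; last by nra.
by apply: (@lt_le_trans _ _ 0); rewrite ?oppr_lt0// mulr_ge0.
Qed.

Lemma is_derive_affine (R : realType) (V : normedModType R) (z : R -> V)
    (a b t : R) (dz : V) : is_derive (a + b * t) 1 z dz ->
  is_derive t 1 (fun x => z (a + b * x)) (b *: dz).
Proof.
move=> [zt <-].
have zt' : differentiable z (a + b * t) by exact/derivable1_diffP.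
have db : is_derive t 1 (fun x : R => a + b * x) b.
  have := is_deriveD (is_derive_cst a t (1 : R))
    (is_deriveZ b (is_derive_id t (1 : R))).
  by rewrite add0r /GRing.scale/= mulr1.
have := @is_derive_comp_curve R R V z (fun x : R => a + b * x) t b zt' db.
by rewrite -[X in 'd z _ X]mulr1 linearZ/= -deriveE.
Qed.

Lemma locally_lipschitzZ (R : realType) (d n : nat) (c : R)
    (v : 'rV[R]_d -> 'rV[R]_n) p :
  locally_lipschitz_at v p -> locally_lipschitz_at (fun y => c *: v y) p.
Proof.
move=> [M [r [r0 lv]]]; exists (c ^+ 2 * M), r; split=> // y y' py py'.
by rewrite -scalerBr sqnormZ -mulrA ler_wpM2l ?sqr_ge0//; exact: lv.
Qed.

(** * The gradient flow: regularity of the field and levels along curves *)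

Section flow.
Context {R : realType} {d : nat} (f : 'rV[R]_d -> R).

Lemma diff_gradient x w : differentiable f x ->
  'd f x w = \sum_i w 0 i * gradient f x 0 i.
Proof.
move=> dfx; rewrite {1}(row_sum_delta w) linear_sum; apply: eq_bigr => i _.
by rewrite linearZ/= mxE deriveE.
Qed.

Lemma flow_fieldE y :
  flow_field f y = (sqnorm (gradient f y))^-1 *: gradient f y.
Proof.
rewrite /flow_field enorm_sqr.
by case: eqVneq => // ->; rewrite scaler0.
Qed.

(** The squared norm in the denominator cancels the gradient paired with itself, so levels rise at
    unit speed. *)
Lemma diff_flow_field x : differentiable f x -> ~ critical f x ->
  'd f x (flow_field f x) = 1.
Proof.
move=> dfx crit; rewrite diff_gradient// flow_fieldE.
under eq_bigr do rewrite mxE -mulrA -expr2.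
rewrite -mulr_sumr mulVf// sqnorm_eq0; exact/eqP.
Qed.

(* Speed [s] may be negative: over [0, 1] the level changes from [u] to [u + s],
   so that the upward and the downward flow are the same case. *)
Definition flow_curve (s T : R) (z : R -> 'rV[R]_d) :=
  forall t : R, 0 <= t <= T -> {for t, continuous z} /\
    (~ critical f (z t) -> is_derive t 1 z (s *: flow_field f (z t))).

Hypothesis hC2 : twice_continuously_differentiable f.

Lemma gradient_continuous : continuous (gradient f).
Proof. by move=> x; apply: differentiable_continuous; case: hC2 => _ + _; exact. Qed.

(** With [N] the squared length of the gradient, inversion divides squared distances by
    [N y * N y']. The gradient is locally Lipschitz and [N] stays above [N p / 2] near [p], which
    bounds the quotient. *)
Lemma flow_field_locally_lipschitz p :
  ~ critical f p -> locally_lipschitz_at (flow_field f) p.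
Proof.
case: hC2 => _ dg ch crit.
have [M [r [r0 lg]]] := C1_locally_lipschitz dg (ch p).
pose N (y : 'rV[R]_d) := sqnorm (gradient f y).
have Np0 : 0 < N p by rewrite lt0r sqnorm_ge0 sqnorm_eq0 andbT; exact/eqP.
have Np20 : 0 < N p / 2 by rewrite divr_gt0.
have cN : N @ p --> N p.
  apply: (@continuous_comp _ _ _ (gradient f) (@sqnorm R d)).
    exact: gradient_continuous.
  exact: sqnorm_continuous.
have : \forall y \near p, N p / 2 < N y.
  apply: (cvgr_gt _ cN).
  by rewrite ltr_pdivrMr// ltr_pMr// ltr1n.
move=> /nbhs_ballP[e /= e0 Ne].
exists (M / (N p / 2 * (N p / 2))), (Num.min r e); split.
  by rewrite lt_min r0 e0.
move=> y y' py py'.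
have [ry ey] : ball p r y /\ ball p e y.
  by split; apply: le_ball py; rewrite ge_min lexx ?orbT.
have [ry' ey'] : ball p r y' /\ ball p e y'.
  by split; apply: le_ball py'; rewrite ge_min lexx ?orbT.
have Ny : N p / 2 < N y by exact: Ne.
have Ny' : N p / 2 < N y' by exact: Ne.
have Ny0 := lt_trans Np20 Ny; have Ny'0 := lt_trans Np20 Ny'.
rewrite !flow_fieldE sqnorm_inversion ?gt_eqF//.
rewrite mulrAC; apply: ler_pM.
- exact: sqnorm_ge0.
- by rewrite invr_ge0 mulr_ge0// sqnorm_ge0.
- exact: lg.
- rewrite lef_pV2 ?posrE ?mulr_gt0//.
  by apply: ler_pM; rewrite ?ltW.
Qed.

(** The level has derivative [s] along the curve, and the mean value theorem integrates it. Only
    continuity is used at the endpoints, so [z T] may itself be critical; [flow_curve_regular]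
    relies on this. *)
Lemma flow_curve_level (s T : R) z : 0 <= T -> flow_curve s T z ->
  (forall t, 0 <= t < T -> ~ critical f (z t)) -> f (z T) = f (z 0) + s * T.
Proof.
case: hC2 => df _ _ T0 hz ncrit.
have dfz (t : R) : t \in `]0, T[ -> is_derive t 1 (f \o z) s.
  rewrite in_itv/= => /andP[t0 tT].
  have nc : ~ critical f (z t) by apply: ncrit; rewrite ltW.
  have [_ /(_ nc) zt] := hz t ltac:(by rewrite !ltW).
  have := is_derive_comp_curve (df (z t)) zt.
  by rewrite linearZ/= diff_flow_field// /GRing.scale/= mulr1.
have cfz : {within `[0, T], continuous (f \o z)}.
  apply: continuous_in_subspaceT => t; rewrite inE/= in_itv/= => tT.
  apply: continuous_comp; first by case: (hz t tT).
  exact: differentiable_continuous.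
have [c _ /= fE] := MVT_segment T0 dfz cfz.
by move: fE; rewrite subr0 => <-; rewrite addrC subrK.
Qed.

(** Real induction: if the curve is regular before [c], its level at [c] is the predicted one, which
    carries no critical point; regularity then persists nearby because the gradient is
    continuous. *)
Lemma flow_curve_regular (s T : R) z : 0 <= T -> flow_curve s T z ->
  (forall t y, 0 <= t <= T -> f y = f (z 0) + s * t -> ~ critical f y) ->
  forall t, 0 <= t <= T -> ~ critical f (z t).
Proof.
move=> T0 hz reg; apply: interval_induction => c cT.
  move=> nc; apply: (reg c) => //; apply: flow_curve_level nc.
    by case/andP: cT.
  move=> t /andP[t0 tc]; apply: hz; rewrite t0 (le_trans tc)//.
  by case/andP: cT.
move=> nc.
have cg : (gradient f \o z) t @[t --> c] --> (gradient f \o z) c.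
  apply: continuous_comp; first by case: (hz c cT).
  exact: gradient_continuous.
have gc0 : (gradient f \o z) c != 0 by exact/eqP.
near=> t; apply/eqP; near: t.
exact: (cvgr_neq0 _ cg gc0).
Unshelve. all: by end_near. Qed.

Lemma gradient_flow_line_curve x z (s : R) : gradient_flow_line f x z ->
  0 < f x -> 0 < f x + s -> flow_curve s 1 (fun t => z (s * t)).
Proof.
(* [f x + s * t] is a convex combination of the positive levels [f x] and [f x + s], so the time
   [s * t] stays after [- f x]. *)
move=> [_ cz dz _] fx0 fxs0 t t01; have fxst := ltrN_mul fx0 fxs0 t01.
split.
  apply: (@continuous_comp _ _ _ (fun t => s * t) z); last exact: cz.
  exact: mulrl_continuous.
move=> nc.
have := @is_derive_affine R _ z 0 s t (flow_field f (z (s * t))).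
rewrite add0r => /(_ (dz _ fxst nc)).
by under eq_fun do rewrite add0r.
Qed.

(** * Transport between regular levels, upward or downward *)

Section transport.
Variable zeta : 'rV[R]_d -> R -> 'rV[R]_d.
Hypothesis hzeta : forall x, gradient_flow_line f x (zeta x).
Variables u s : R.
Hypothesis u0 : 0 < u.
Hypothesis us0 : 0 < u + s.
Hypothesis reg : forall t y, 0 <= t <= 1 -> f y = u + s * t -> ~ critical f y.

Lemma zeta_curve x : f x = u -> flow_curve s 1 (fun t => zeta x (s * t)).
Proof. by move=> fxu; apply: (gradient_flow_line_curve (hzeta x)); rewrite fxu. Qed.

Lemma zeta_start x : zeta x 0 = x.
Proof. by case: (hzeta x). Qed.

Lemma zeta_regular x t : f x = u -> 0 <= t <= 1 -> ~ critical f (zeta x (s * t)).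
Proof.
move=> fxu t01.
apply: (flow_curve_regular ler01 (zeta_curve fxu)) => // {t01}t y.
by rewrite mulr0 zeta_start fxu; exact: reg.
Qed.

Lemma zeta_derive x (t : R) : f x = u -> 0 <= t <= 1 ->
  is_derive t 1 (fun t => zeta x (s * t)) (s *: flow_field f (zeta x (s * t))).
Proof.
move=> fxu t01; have [_] := zeta_curve fxu t01; apply.
exact: zeta_regular.
Qed.

Lemma zeta_level x : f x = u -> f (zeta x s) = u + s.
Proof.
move=> fxu.
have := flow_curve_level ler01 (zeta_curve fxu).
rewrite mulr0 zeta_start mulr1 fxu; apply => t /andP[t0 t1].
by apply: zeta_regular => //; rewrite t0 ltW.
Qed.

Lemma zeta_tube x : f x = u -> exists M, 0 < M /\
  forall t, 0 <= t <= 1 -> forall y, M * sqnorm (y - zeta x (s * t)) < 1 ->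
    sqnorm (s *: flow_field f y - s *: flow_field f (zeta x (s * t))) <=
    M * sqnorm (y - zeta x (s * t)).
Proof.
move=> fxu.
apply: (@lipschitz_tube _ _ _ (fun y => s *: flow_field f y)
  (fun t => zeta x (s * t))) => t t01; first by case: (zeta_curve fxu t01).
apply: locally_lipschitzZ; apply: flow_field_locally_lipschitz.
exact: zeta_regular.
Qed.

(** The constants depend on the flow line from [x], not on [w]. Curves [w] starting near [x] give
    continuous dependence; those starting at [x] give uniqueness. *)
Lemma zeta_close x : f x = u -> exists M C : R, 0 < M /\ 0 < C /\
  forall w : R -> 'rV[R]_d,
    (forall t : R, 0 <= t <= 1 -> is_derive t 1 w (s *: flow_field f (w t))) ->
    M * (sqnorm (w 0 - x) * C) < 1 ->
    sqnorm (w 1 - zeta x s) <= sqnorm (w 0 - x) * C.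
Proof.
move=> fxu; have [M [M0 tube]] := zeta_tube fxu.
exists M, (expR ((1 + M) * 1)); split=> //; split; first exact: expR_gt0.
move=> w dw.
have := @integral_curves_close _ _ (fun y => s *: flow_field f y)
  (fun t => zeta x (s * t)) w 1 M ler01 _ dw M0 tube.
rewrite mulr0 (mulr1 s) zeta_start; apply.
by move=> t t01; exact: zeta_derive.
Qed.

Lemma zeta_continuous : {within level_set f u, continuous (zeta^~ s)}.
Proof.
apply/subspace_continuousP => x fxu.
have [M [C [M0 [C0 close]]]] := zeta_close fxu.
apply/cvgrPdist_lt => e e0.
have cn : sqnorm (y - x) @[y --> x] --> (0 : R).
  rewrite -(@sqnorm0 R d) -[in X in _ --> X](subrr x).
  have cB : {for x, continuous (fun y : 'rV[R]_d => y - x)}.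
    by apply: continuousB; [move=> ?|exact: cst_continuous].
  exact: (continuous_comp cB (@sqnorm_continuous R d _)).
have sm k : 0 < k -> \forall y \near within (level_set f u) (nbhs x),
    sqnorm (y - x) < k.
  by move=> k0; apply: cvg_within; exact: (cvgr_lt _ cn).
(* Two thresholds on [sqnorm (y - x)] follow: [1 / (M * C)] to enter the tube estimate, [e ^+ 2 / C]
   for the final distance. *)
near=> y.
have fyu : f y = u by near: y; exact: withinT.
have yM : M * (sqnorm (y - x) * C) < 1.
  rewrite mulrA mulrAC -ltr_pdivlMl ?mulr_gt0// mulr1.
  by near: y; apply: sm; rewrite invr_gt0 mulr_gt0.
rewrite distrC -(@ltr_pXn2r _ 2) ?nnegrE ?(ltW e0)//.
apply: le_lt_trans (norm_sqr_le_sqnorm _) _.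
have := close (fun t => zeta y (s * t)); rewrite mulr0 mulr1 zeta_start.
move=> H; apply: le_lt_trans (H _ yM) _.
  by move=> t t01; exact: zeta_derive.
rewrite -ltr_pdivlMr//; near: y; apply: sm.
by rewrite divr_gt0// exprn_gt0.
Unshelve. all: by end_near. Qed.

End transport.

(** The flow line from [x] run backwards is an integral curve of speed [- s] issuing from
    [zeta x s], as is the reverse transport from that point; uniqueness makes their endpoints
    agree. *)
Lemma zetaK (zeta : 'rV[R]_d -> R -> 'rV[R]_d) (u s : R) :
  (forall x, gradient_flow_line f x (zeta x)) -> 0 < u -> 0 < u + s ->
  (forall t y, 0 <= t <= 1 -> f y = u + s * t -> ~ critical f y) ->
  forall x, f x = u -> zeta (zeta x s) (- s) = x.
Proof.
move=> hzeta u0 us0 reg x fxu.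
have fy : f (zeta x s) = u + s by exact: (zeta_level hzeta).
have reg' t y : 0 <= t <= 1 -> f y = (u + s) + - s * t -> ~ critical f y.
  move=> /andP[t0 t1] fyt; apply: (reg (1 - t)).
    by rewrite subr_ge0 t1 gerBl.
  by rewrite fyt; ring.
have uss0 : 0 < u + s + - s by rewrite addrK.
have [M [C [M0 [C0 close]]]] := zeta_close hzeta us0 uss0 reg' fy.
(* Equal starting points make the right-hand side of the estimate zero. *)
have := close (fun t => zeta x (s + - s * t)).
rewrite mulr0 addr0 mulr1 (subrr s) (zeta_start hzeta) subrr sqnorm0 mul0r mulr0 => H.
have : sqnorm (x - zeta (zeta x s) (- s)) <= 0.
  apply: H => // t /andP[t0 t1].
  have nc : ~ critical f (zeta x (s + - s * t)).
    have -> : s + - s * t = s * (1 - t) by ring.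
    by apply: (zeta_regular hzeta u0 us0 reg fxu); rewrite subr_ge0 t1 gerBl.
  apply: is_derive_affine.
  have [_ _ + _] := hzeta x; apply => //.
  have -> : s + - s * t = s * (1 - t) by ring.
  by apply: ltrN_mul; rewrite ?fxu// subr_ge0 t1 gerBl.
by rewrite le_eqVlt ltNge sqnorm_ge0 orbF sqnorm_eq0 subr_eq0 => /eqP.
Qed.

End flow.

Theorem theorem4p6 (R : realType) (d : nat) (f : 'rV[R]_d -> R)
    (zeta : 'rV[R]_d -> R -> 'rV[R]_d)
    (hdensity : probability_density f)
    (hC2 : twice_continuously_differentiable f)
    (hmorse : morse_inside_support f)
    (hzeta : forall x : 'rV[R]_d, gradient_flow_line f x (zeta x)) :
  (forall (x : 'rV[R]_d) (t s : R),
      0 < t -> f x = t -> t < s -> (s%:E < max_value f)%E ->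
      (forall tau : R, 0 <= tau <= s - t -> ~ critical f (zeta x tau)) ->
      f (zeta x (s - t)) = s)
  /\
  (forall t s : R,
      0 < t -> t < s -> (s%:E < max_value f)%E ->
      ~ (exists x : 'rV[R]_d, t <= f x <= s /\ critical f x) ->
      homeomorphism_between (level_set f t) (level_set f s)
        (fun x : 'rV[R]_d => zeta x (s - t))).
Proof.
split.
  move=> x t s t0 fxt ts _ nc.
  have st0 : 0 <= s - t by rewrite subr_ge0 ltW.
  have st1 : 0 < t + (s - t) by rewrite addrC subrK (lt_trans t0).
  have hz : flow_curve f (s - t) 1 (fun r => zeta x ((s - t) * r)).
    by apply: (gradient_flow_line_curve (hzeta x)); rewrite fxt.
  (* Only the flow line from [x] is assumed regular, not whole levels, so the level formula is
     applied directly. *)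
  have := flow_curve_level hC2 ler01 hz.
  rewrite mulr0 mulr1 (zeta_start hzeta) fxt [t + _]addrC subrK; apply => r /andP[r0 r1].
  by apply: nc; rewrite mulr_ge0//= ler_piMr// ltW.
move=> t s t0 ts _ nocrit.
have s0 := lt_trans t0 ts.
have st : t + (s - t) = s by rewrite addrC subrK.
have ts' : s + (t - s) = t by rewrite addrC subrK.
have tsN : t - s = - (s - t) by rewrite opprB.
have stN : s - t = - (t - s) by rewrite opprB.
have reg r y : 0 <= r <= 1 -> f y = t + (s - t) * r -> ~ critical f y.
  move=> /andP[r0 r1] fy cy; apply: nocrit; exists y; split=> //.
  by rewrite fy; apply/andP; split; nra.
have reg' r y : 0 <= r <= 1 -> f y = s + (t - s) * r -> ~ critical f y.
  move=> /andP[r0 r1] fy cy; apply: nocrit; exists y; split=> //.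
  by rewrite fy; apply/andP; split; nra.
have st0 : 0 < t + (s - t) by rewrite st.
have ts0 : 0 < s + (t - s) by rewrite ts'.
(* Transport back from [s] to [t] has speed [t - s]. Cancellation in both orders gives injectivity,
   surjectivity and the inverse map. *)
have K x : f x = t -> zeta (zeta x (s - t)) (t - s) = x.
  by rewrite tsN; exact: (zetaK hC2 hzeta t0 st0 reg).
have K' y : f y = s -> zeta (zeta y (t - s)) (s - t) = y.
  by rewrite stN; exact: (zetaK hC2 hzeta s0 ts0 reg').
split.
- split.
  + by move=> x fx; rewrite /level_set/= (zeta_level hC2 hzeta t0 st0 reg fx).
  + by move=> x y; rewrite !inE => fx fy xy; rewrite -(K x)// xy K.
  + move=> y fy; exists (zeta y (t - s)); last exact: K'.
    by rewrite /level_set/= (zeta_level hC2 hzeta s0 ts0 reg' fy).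
- exact: (zeta_continuous hC2 hzeta t0 st0 reg).
- exists (zeta^~ (t - s)); split; first exact: K.
  exact: (zeta_continuous hC2 hzeta s0 ts0 reg').
Qed.
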